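(* Assume that $\mathcal{N}(\mathbf{A}(\mathbf{y}))\cap\mathcal{N}(\mathbf{L})=\{\mathbf{0}\}$ for every $\mathbf{y}$ in a domain $\Omega\subset\mathbb{R}^r$ and that the map $\mathbf{y}\mapsto\mathbf{A}(\mathbf{y})$ is differentiable in $\Omega$. Let $\mathcal{F}(\mathbf{x},\mathbf{y})=\frac12\|\mathbf{K}(\mathbf{y})\mathbf{x}-\mathbf{d}\|^2+\mathcal{R}(\mathbf{y})$ for $(\mathbf{x},\mathbf{y})\in\mathbb{R}^n\times\Omega$, and $\varphi(\mathbf{y})=\mathcal{F}(\mathbf{K}(\mathbf{y})^\dagger\mathbf{d},\mathbf{y})=\frac12\|\mathbf{f}(\mathbf{y})\|^2+\mathcal{R}(\mathbf{y})$ for $\mathbf{y}\in\Omega$. (1) If $(\mathbf{x}^*,\mathbf{y}^* )$ is a global minimizer of $\mathcal{F}$ in $\mathbb{R}^n\times\Omega$, then $\mathbf{x}^*=\mathbf{K}(\mathbf{y}^* )^\dagger\mathbf{d}$ and $\mathbf{y}^*$ is a global minimizer of $\varphi$ in $\Omega$. (2) If $\mathbf{y}^*$ is a critical point (respectively, a global minimizer) of $\varphi$ in $\Omega$ and $\mathbf{x}^*=\mathbf{K}(\mathbf{y}^* )^\dagger\mathbf{d}$, then $(\mathbf{x}^*,\mathbf{y}^* )$ is a critical point (respectively, a global minimizer) of $\mathcal{F}$ in $\mathbb{R}^n\times\Omega$.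
   Context: Here $\mathbf{A}(\mathbf{y})\in\mathbb{R}^{m\times n}$ with $m\ge n$, $\mathbf{L}\in\mathbb{R}^{q\times n}$, $\mathbf{b}\in\mathbb{R}^m$, $\lambda>0$ are given, $\mathcal{N}(\cdot)$ denotes the null space, $\|\cdot\|$ is the Euclidean norm, and $\mathcal{R}$ is a real-valued continuously differentiable function of $\mathbf{y}$. A domain is an open connected set. Define $$\mathbf{K}(\mathbf{y})=\begin{bmatrix}\mathbf{A}(\mathbf{y})\\ \lambda\mathbf{L}\end{bmatrix}\in\mathbb{R}^{(m+q)\times n},\qquad \mathbf{d}=\begin{bmatrix}\mathbf{b}\\ \mathbf{0}\end{bmatrix}\in\mathbb{R}^{m+q}.$$ The null space condition makes $\mathbf{K}(\mathbf{y})$ of full column rank, and $\mathbf{K}(\mathbf{y})^\dagger=(\mathbf{K}(\mathbf{y})^\top\mathbf{K}(\mathbf{y}))^{-1}\mathbf{K}(\mathbf{y})^\top$ is its Moore-Penrose pseudoinverse. Set $\mathcal{P}^\perp_{\mathbf{K}(\mathbf{y})}=\mathbf{I}-\mathbf{K}(\mathbf{y})\mathbf{K}(\mathbf{y})^\dagger$ and $\mathbf{f}(\mathbf{y})=-\mathcal{P}^\perp_{\mathbf{K}(\mathbf{y})}\mathbf{d}$. A critical point is a point where the gradient vanishes. *)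

(* Defs.v *)
From HB Require Import structures.
From mathcomp Require Export all_boot all_order all_algebra.
From mathcomp Require Export all_classical all_reals all_analysis.
Export Order.TTheory GRing.Theory Num.Theory.
Export numFieldNormedType.Exports.

#[export] Set Implicit Arguments.
#[export] Unset Strict Implicit.
#[export] Unset Printing Implicit Defensive.

Local Open Scope classical_set_scope.
Local Open Scope ring_scope.

(* Points of R^k are column vectors.  The library norm `|v| on matrices is the
   max norm: it has the right topology and notion of differentiability, but the
   Euclidean norm has to be defined. *)
Definition enorm (R : realType) (k : nat) (v : 'cV[R]_k) : R :=
  Num.sqrt (\sum_(i < k) v i 0 ^+ 2).

Definition nullspace (R : realType) (k n : nat) (M : 'M[R]_(k, n)) :
    set 'cV[R]_n :=
  [set x | M *m x = 0].

Definition is_domain (R : realType) (k : nat) (S : set 'cV[R]_k) : Prop :=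
  open S /\ connected S.

Definition gradient (R : realType) (k : nat) (f : 'cV[R]_k -> R)
    (p : 'cV[R]_k) : 'cV[R]_k :=
  \col_(i < k) 'D_(delta_mx i 0) f p.

(* [gradient] is total, so differentiability is required explicitly. *)
Definition critical_point (R : realType) (k : nat) (S : set 'cV[R]_k)
    (f : 'cV[R]_k -> R) (p : 'cV[R]_k) : Prop :=
  [/\ S p, differentiable f p & gradient f p = 0].

Definition global_minimizer (R : realType) (k : nat) (S : set 'cV[R]_k)
    (f : 'cV[R]_k -> R) (p : 'cV[R]_k) : Prop :=
  S p /\ forall q, S q -> f p <= f q.

(* For use on an open set S. *)
Definition continuously_differentiable_on (R : realType) (k : nat)
    (S : set 'cV[R]_k) (f : 'cV[R]_k -> R) : Prop :=
  forall p, S p -> differentiable f p /\ {for p, continuous (gradient f)}.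

(* The Moore-Penrose inverse of a matrix of full column rank; [invmx] returns
   its argument on singular matrices, so this is meaningless otherwise. *)
Definition pinv (R : realType) (k n : nat) (M : 'M[R]_(k, n)) : 'M[R]_(n, k) :=
  invmx (M^T *m M) *m M^T.

Definition proj_perp (R : realType) (k n : nat) (M : 'M[R]_(k, n)) : 'M[R]_k :=
  1%:M - M *m pinv M.

Section Objective.
Variables (R : realType) (m n q r : nat).
Variables (A : 'cV[R]_r -> 'M[R]_(m, n)) (L : 'M[R]_(q, n)) (b : 'cV[R]_m).
Variables (lambda : R) (Reg : 'cV[R]_r -> R).

Definition Kmx (y : 'cV[R]_r) : 'M[R]_(m + q, n) := col_mx (A y) (lambda *: L).

Definition dvec : 'cV[R]_(m + q) := col_mx b 0.

Definition fres (y : 'cV[R]_r) : 'cV[R]_(m + q) :=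
  - (proj_perp (Kmx y) *m dvec).

(* R^n x R^r is identified with R^(n + r): the pair (x, y) is [col_mx x y]. *)
Definition Fobj (z : 'cV[R]_(n + r)) : R :=
  let x := usubmx z in
  let y := dsubmx z in
  2^-1 * enorm (Kmx y *m x - dvec) ^+ 2 + Reg y.

Definition xopt (y : 'cV[R]_r) : 'cV[R]_n := pinv (Kmx y) *m dvec.

Definition phi (y : 'cV[R]_r) : R := Fobj (col_mx (xopt y) y).

End Objective.

Definition cylinder (R : realType) (n r : nat) (S : set 'cV[R]_r) :
    set 'cV[R]_(n + r) :=
  [set z | S (dsubmx z)].
Arguments cylinder {R} n {r} S.

(* Main.v *)
Require Import Defs.
Local Open Scope classical_set_scope.
Local Open Scope ring_scope.

(** The objective [Fobj] is, for fixed y, a linear least squares problem in x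
    whose matrix K(y) has full column rank.  Its minimizer is
    xopt y = pinv (K y) *m d, and since the residual at xopt y is orthogonal
    to the column space of K(y), Pythagoras ([enorm_residual]) gives the exact
    splitting
<<
      F (x, y) = phi y + 1/2 |K(y) (x - xopt y)|^2        (Fobj_phi)
>>
    in which the last term vanishes only at x = xopt y.  Everything about
    global minimizers follows: F is bounded below by phi o snd, with equality
    exactly on the graph of xopt, so minimizing F amounts to minimizing phi
    and then setting x = xopt y.

    For critical points, phi is the composite of F with the section
    s : y |-> (xopt y, y).  Both are differentiable: F is a polynomial in x and
    the entries of A, plus the regularization term, and xopt is differentiable
    because the Gram matrix K(y)^T K(y) is invertible and matrix inversion is
    differentiable at invertible matrices by the adjugate formula
    ([differentiable_invmx]).  At (xopt y, y) the differential of F vanishes on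
    the directions (u, 0), as x |-> F (x, y) is minimal there
    ([diff_line_min]).  By the chain rule the differential of phi in the
    direction v is thus that of F in any direction (u, v)
    ([diff_Fobj_xopt]): the unknown derivative of xopt does not contribute.
    Hence the one vanishes as soon as the other does. *)

(** * Differentiability of matrix-valued maps *)

(** Differentiability is a local property: the Taylor expansion of f at x is
    also one of g, with the same differential.  It is what allows [invmx] to be
    replaced by the adjugate formula, which is valid near invertible matrices
    only. *)
Lemma near_eq_differentiable (R : realType) (V W : normedModType R)
    (f g : V -> W) (x : V) :
  (\forall y \near x, f y = g y) -> differentiable f x -> differentiable g x.
Proof.
move=> fg df.
have fgx : f x = g x by exact: nbhs_singleton fg.
have dg : g \o shift x = cst (g x) + 'd f x +o_ 0 id.
  apply/eqaddoP => e e0; have /diff_locallyP[_ /eqaddoP/(_ e e0) fo] := df.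
  have /= fgs : \forall h \near (0 : V), f (h + x) = g (h + x).
    by move: fg; rewrite (near_shift 0) subr0.
  near=> h.
  have -> : (g \o shift x - (cst (g x) + 'd f x)) h =
            (f \o shift x - (cst (f x) + 'd f x)) h.
    rewrite /= /GRing.add /GRing.opp /= fgx; congr (_ - _).
    by apply/esym; near: h.
  by near: h.
apply/diff_locallyP; rewrite (diff_unique (diff_continuous df) dg).
by split=> //; exact: diff_continuous.
Unshelve. all: by end_near. Qed.

Section Entrywise.
Variables (R : realType) (V : normedModType R).

Lemma differentiable_bigsum (I : finType) (f : I -> V -> R) (x : V) :
  (forall i, differentiable (f i) x) ->
  differentiable (fun y => \sum_i f i y) x.
Proof.
move=> df; rewrite -fct_sumE; elim/big_ind: _ => [|g h|i _] //.
exact: differentiableD.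
Qed.

Lemma differentiable_bigprod (I : finType) (f : I -> V -> R) (x : V) :
  (forall i, differentiable (f i) x) ->
  differentiable (fun y => \prod_i f i y) x.
Proof.
move=> df; rewrite -fct_prodE; elim/big_ind: _ => [|g h|i _] //.
exact: differentiableM.
Qed.

Lemma differentiable_entry (m n : nat) (M : V -> 'M[R]_(m, n)) x i j :
  differentiable M x -> differentiable (fun y => M y i j) x.
Proof.
move=> dM.
exact: (differentiable_comp dM (differentiable_coord (M x) i j)).
Qed.

Lemma differentiable_entries (m n : nat) (M : V -> 'M[R]_(m, n)) x :
  (forall i j, differentiable (fun y => M y i j) x) -> differentiable M x.
Proof.
move=> dM.
have -> : M = \sum_(i < m) \sum_(j < n) (fun y => M y i j *: delta_mx i j).
  apply/funext => y; rewrite [LHS]matrix_sum_delta fct_sumE.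
  by apply: eq_bigr => i _; rewrite fct_sumE.
apply: differentiable_sum => i; apply: differentiable_sum => j.
exact: differentiableZl.
Qed.

Lemma differentiable_mulmx (m n p : nat) (M : V -> 'M[R]_(m, n))
    (N : V -> 'M[R]_(n, p)) x :
  differentiable M x -> differentiable N x ->
  differentiable (fun y => M y *m N y) x.
Proof.
move=> dM dN; apply: differentiable_entries => i j.
under [X in differentiable X _]eq_fun do rewrite mxE.
apply: differentiable_bigsum => k.
by apply: differentiableM; exact: differentiable_entry.
Qed.

Lemma differentiable_trmx (m n : nat) (M : V -> 'M[R]_(m, n)) x :
  differentiable M x -> differentiable (fun y => (M y)^T) x.
Proof.
move=> dM; apply: differentiable_entries => i j.
under [X in differentiable X _]eq_fun do rewrite mxE.
exact: differentiable_entry.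
Qed.

Lemma differentiable_col_mx (m n p : nat) (M : V -> 'M[R]_(m, p))
    (N : V -> 'M[R]_(n, p)) x :
  differentiable M x -> differentiable N x ->
  differentiable (fun y => col_mx (M y) (N y)) x.
Proof.
move=> dM dN; apply: differentiable_entries => i j.
under [X in differentiable X _]eq_fun do rewrite mxE.
by case: (fintype.split i) => k; exact: differentiable_entry.
Qed.

Lemma differentiable_det (n : nat) (M : V -> 'M[R]_n) x :
  differentiable M x -> differentiable (fun y => \det (M y)) x.
Proof.
move=> dM; apply: differentiable_bigsum => s.
apply: (@differentiableM _ _ (cst _)); first exact: differentiable_cst.
by apply: differentiable_bigprod => i; exact: differentiable_entry.
Qed.

(** Near x the determinant stays nonzero, so the inverse is the adjugate over
    the determinant there, a rational function of the entries. *)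
Lemma differentiable_invmx (n : nat) (M : V -> 'M[R]_n) x :
  differentiable M x -> M x \in unitmx ->
  differentiable (fun y => invmx (M y)) x.
Proof.
move=> dM; rewrite unitmxE unitfE => det_neq0.
have ddet := differentiable_det dM.
apply: (@near_eq_differentiable _ _ _
  (fun y => (\det (M y))^-1 *: \adj (M y))).
  have near_neq0 : \forall y \near x, \det (M y) != 0.
    exact: cvgr_neq0 (differentiable_continuous ddet) det_neq0.
  near=> y; rewrite /invmx unitmxE unitfE ifT//.
  by near: y.
apply: differentiable_entries => i j.
under [X in differentiable X _]eq_fun do rewrite mxE /adjugate mxE /cofactor.
apply: differentiableM; first exact: differentiableV.
apply: (@differentiableM _ _ (cst _)); first exact: differentiable_cst.
apply: differentiable_det; apply: differentiable_entries => k l.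
under [X in differentiable X _]eq_fun do rewrite !mxE.
exact: differentiable_entry.
Unshelve. all: by end_near. Qed.

End Entrywise.

Lemma differentiable_dsubmx (R : realType) (m n p : nat)
    (M : 'M[R]_(m + n, p)) : differentiable (@dsubmx R m n p) M.
Proof.
apply: differentiable_entries => i j.
under [X in differentiable X _]eq_fun do rewrite mxE.
exact: differentiable_coord.
Qed.

Lemma differentiable_usubmx (R : realType) (m n p : nat)
    (M : 'M[R]_(m + n, p)) : differentiable (@usubmx R m n p) M.
Proof.
apply: differentiable_entries => i j.
under [X in differentiable X _]eq_fun do rewrite mxE.
exact: differentiable_coord.
Qed.

Lemma diff_dsubmx (R : realType) (m n p : nat) (M : 'M[R]_(m + n, p)) :
  'd (@dsubmx R m n p) M = @dsubmx R m n p :> (_ -> _).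
Proof.
apply: diff_lin => N.
exact/differentiable_continuous/differentiable_dsubmx.
Qed.

(** * Vanishing of differentials *)

Section CriticalPoints.
Variables (R : realType) (k : nat).

Lemma diff_gradient (f : 'cV[R]_k -> R) p v : differentiable f p ->
  'd f p v = \sum_(i < k) v i 0 * gradient f p i 0.
Proof.
move=> df; rewrite {1}[v]matrix_sum_delta linear_sum; apply: eq_bigr => i _.
by rewrite linear_sum big_ord1 linearZ /= mxE deriveE.
Qed.

Lemma gradient_eq0P (f : 'cV[R]_k -> R) p : differentiable f p ->
  gradient f p = 0 <-> forall v, 'd f p v = 0.
Proof.
move=> df; split=> [g0 v|d0].
  by rewrite diff_gradient// g0 big1// => i _; rewrite mxE mulr0.
by apply/colP => i; rewrite !mxE deriveE.
Qed.

(** Fermat's rule along the line through p in the direction v. *)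
Lemma diff_line_min (V : normedModType R) (f : V -> R) p v :
  (forall t, differentiable f (p + t *: v)) ->
  (forall t, f p <= f (p + t *: v)) -> 'd f p v = 0.
Proof.
move=> df fmin; pose l (t : R) : V := p + t *: v.
have dl t : is_diff t l ( *:%R^~ v).
  have := is_diffD (@is_diff_cst _ _ _ p t) (is_diff_scalel t v).
  by rewrite add0r.
have dfl t : differentiable (f \o l) t.
  by apply: differentiable_comp; [exact: ex_diff | exact: df].
have : is_derive (0 : R) 1 (f \o l) 0.
  apply: (@derive1_at_min _ _ (- 1) 1).
  - by rewrite ge0_cp.
  - by move=> t _; apply/derivable1_diffP.
  - by rewrite in_itv /= ltrN10 ltr01.
  - by move=> t _; rewrite /l /= scale0r addr0.
move=> /(@derive_val _ _ _ _ _ _ _); rewrite deriveE//.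
rewrite diff_comp; [|exact: ex_diff | exact: df].
by rewrite /= diff_val scale1r /l scale0r addr0.
Qed.

End CriticalPoints.

(** * Linear least squares with an injective matrix *)

Section LeastSquares.
Variable R : realType.

Lemma sqr_enorm (k : nat) (v : 'cV[R]_k) : enorm v ^+ 2 = (v^T *m v) 0 0.
Proof.
rewrite sqr_sqrtr ?sumr_ge0// => [|i _]; last exact: sqr_ge0.
by rewrite mxE; apply: eq_bigr => i _; rewrite mxE.
Qed.

Lemma enorm_sqr_eq0 (k : nat) (v : 'cV[R]_k) : enorm v ^+ 2 = 0 -> v = 0.
Proof.
rewrite sqr_sqrtr ?sumr_ge0// => [|i _]; last exact: sqr_ge0.
move=> /psumr_eq0P v0; apply/colP => i; rewrite mxE.
by apply/eqP; rewrite -sqrf_eq0 v0// => j _; exact: sqr_ge0.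
Qed.

Variables (k n : nat) (M : 'M[R]_(k, n)).
Variable M_inj : forall x : 'cV[R]_n, M *m x = 0 -> x = 0.

(** If v M^T M = 0 then |M v^T|^2 = v M^T M v^T = 0, so v = 0 by injectivity. *)
Lemma gram_unitmx : M^T *m M \in unitmx.
Proof.
rewrite unitmxE unitfE; apply/det0P => -[v /eqP v_neq0 vG].
apply: v_neq0; apply: trmx_inj; rewrite trmx0; apply: M_inj.
apply: enorm_sqr_eq0; rewrite sqr_enorm trmx_mul trmxK !mulmxA.
by rewrite -(mulmxA v) vG mul0mx mxE.
Qed.

Lemma normal_equation (d : 'cV_k) : M^T *m (M *m (pinv M *m d) - d) = 0.
Proof.
by rewrite mulmxBr !mulmxA mulmxV ?gram_unitmx// mul1mx subrr.
Qed.

(** Pythagoras: by the normal equation the optimal residual is orthogonal to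
    the column space of M, in particular to M (x - pinv M d). *)
Lemma enorm_residual (d : 'cV_k) x :
  enorm (M *m x - d) ^+ 2 =
  enorm (M *m (pinv M *m d) - d) ^+ 2 + enorm (M *m (x - pinv M *m d)) ^+ 2.
Proof.
have := normal_equation d; set x0 := pinv M *m d; set u := _ - d => Mu.
have -> : M *m x - d = u + M *m (x - x0).
  by rewrite mulmxBr /u [RHS]addrC addrA subrK.
set w := x - x0; clearbody u w.
rewrite !sqr_enorm [(u + _)^T]raddfD /= mulmxDl !mulmxDr.
have uMw : u^T *m (M *m w) = 0.
  by apply: trmx_inj; rewrite !trmx_mul trmxK -mulmxA Mu mulmx0 trmx0.
have -> : (M *m w)^T *m u = 0 by rewrite trmx_mul -mulmxA Mu mulmx0.
by rewrite uMw addr0 add0r mxE.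
Qed.

End LeastSquares.

(** * The reduced objective *)

Section VariableProjection.
Variables (R : realType) (m n q r : nat).
Variables (A : 'cV[R]_r -> 'M[R]_(m, n)) (L : 'M[R]_(q, n)) (b : 'cV[R]_m).
Variables (lambda : R) (Reg : 'cV[R]_r -> R).

Local Notation K := (Kmx A L lambda).
Local Notation d := (dvec q b).
Local Notation F := (Fobj A L b lambda Reg).
Local Notation xhat := (xopt A L b lambda).

Lemma Fobj_col_mx x y :
  F (col_mx x y) = 2^-1 * enorm (K y *m x - d) ^+ 2 + Reg y.
Proof. by rewrite /Fobj col_mxKu col_mxKd. Qed.

Lemma Kmx_inj y (x : 'cV[R]_n) : 0 < lambda ->
  nullspace (A y) `&` nullspace L = [set 0] -> K y *m x = 0 -> x = 0.
Proof.
move=> lambda_gt0 null0; rewrite mul_col_mx => /eqP.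
rewrite col_mx_eq0 => /andP[/eqP Ax /eqP].
rewrite -scalemxAl => /eqP; rewrite scaler_eq0 gt_eqF//= => /eqP Lx.
by have : [set 0] x by rewrite -null0.
Qed.

Lemma differentiable_Kmx y : differentiable A y -> differentiable K y.
Proof.
move=> dA; apply: differentiable_col_mx => //; exact: differentiable_cst.
Qed.

Lemma differentiable_xopt y : (forall x : 'cV[R]_n, K y *m x = 0 -> x = 0) ->
  differentiable A y -> differentiable xhat y.
Proof.
move=> K_inj /differentiable_Kmx dK.
apply: differentiable_mulmx; last exact: differentiable_cst.
apply: differentiable_mulmx; last exact: differentiable_trmx.
apply: differentiable_invmx; last exact: gram_unitmx.
by apply: differentiable_mulmx => //; exact: differentiable_trmx.
Qed.

Lemma differentiable_Fobj z :
  differentiable A (dsubmx z) -> differentiable Reg (dsubmx z) ->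
  differentiable F z.
Proof.
move=> dA dReg.
have dd := differentiable_dsubmx z.
have du := differentiable_usubmx z.
have dres : differentiable
    (fun z : 'cV[R]_(n + r) => K (dsubmx z) *m usubmx z - d) z.
  apply: differentiableB; last exact: differentiable_cst.
  apply: differentiable_mulmx => //.
  exact: differentiable_comp dd (differentiable_Kmx dA).
rewrite /Fobj /=.
apply: differentiableD; last exact: differentiable_comp dd dReg.
apply: (@differentiableM _ _ (cst _)); first exact: differentiable_cst.
under [X in differentiable X _]eq_fun do rewrite sqr_enorm.
apply: differentiable_entry; apply: differentiable_mulmx => //.
exact: differentiable_trmx.
Qed.

Lemma Fobj_phi x y : (forall x : 'cV[R]_n, K y *m x = 0 -> x = 0) ->
  F (col_mx x y) =
  phi A L b lambda Reg y + 2^-1 * enorm (K y *m (x - xhat y)) ^+ 2.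
Proof.
move=> K_inj; rewrite /phi !Fobj_col_mx (enorm_residual K_inj).
by rewrite mulrDr addrAC.
Qed.

Lemma phi_le_Fobj x y : (forall x : 'cV[R]_n, K y *m x = 0 -> x = 0) ->
  phi A L b lambda Reg y <= F (col_mx x y).
Proof.
by move=> K_inj; rewrite Fobj_phi// lerDl mulr_ge0 ?invr_ge0 ?sqr_ge0.
Qed.

(** Envelope theorem: at the inner minimizer the x-part u of the direction is
    irrelevant, so the chain rule for phi = F o s, whose direction is
    (d xopt v, v), may be read with any other u. *)
Lemma diff_Fobj_xopt y v : (forall x : 'cV[R]_n, K y *m x = 0 -> x = 0) ->
  differentiable A y -> differentiable Reg y ->
  differentiable (phi A L b lambda Reg) y /\
  forall u, 'd F (col_mx (xhat y) y) (col_mx u v) =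
            'd (phi A L b lambda Reg) y v.
Proof.
move=> K_inj dA dReg.
have dF x : differentiable F (col_mx x y).
  by apply: differentiable_Fobj; rewrite col_mxKd.
pose s y : 'cV[R]_(n + r) := col_mx (xhat y) y.
have ds : differentiable s y.
  by apply: differentiable_col_mx => //; exact: differentiable_xopt.
have -> : phi A L b lambda Reg = F \o s by [].
split; first exact: differentiable_comp ds (dF _).
have dsu : dsubmx ('d s y v) = v.
  have := diff_comp ds (differentiable_dsubmx (s y)).
  rewrite diff_dsubmx => /(congr1 (@^~ v)) /= <-.
  have -> : dsubmx \o s = id by apply/funext => z; rewrite /= col_mxKd.
  by rewrite diff_val.
have d0 u : 'd F (col_mx (xhat y) y) (col_mx u 0) = 0.
  have shift t :
      col_mx (xhat y) y + t *: col_mx u 0 = col_mx (xhat y + t *: u) y.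
    by rewrite scale_col_mx scaler0 add_col_mx addr0.
  by apply: diff_line_min => t; rewrite shift//; exact: phi_le_Fobj.
have dFu u w : 'd F (s y) (col_mx u w) = 'd F (s y) (col_mx 0 w).
  by rewrite -[u in LHS]addr0 -[w in LHS]add0r -add_col_mx linearD d0 add0r.
move=> u; rewrite (diff_comp ds (dF _)) /= -[in RHS](vsubmxK ('d s y v)) dsu.
by rewrite [LHS]dFu [RHS]dFu.
Qed.

End VariableProjection.

Theorem theorem2p1 (R : realType) (m n q r : nat)
    (A : 'cV[R]_r -> 'M[R]_(m, n)) (L : 'M[R]_(q, n)) (b : 'cV[R]_m)
    (lambda : R) (Reg : 'cV[R]_r -> R) (Omega : set 'cV[R]_r)
    (le_nm : (n <= m)%N) (lambda_gt0 : 0 < lambda)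
    (domOmega : is_domain Omega)
    (RegC1 : continuously_differentiable_on Omega Reg)
    (null_cap : forall y, Omega y ->
      nullspace (A y) `&` nullspace L = [set 0])
    (diffA : forall y, Omega y -> differentiable A y) :
  let K := Kmx A L lambda in
  let d := dvec q b in
  let f := fres A L b lambda in
  let F := Fobj A L b lambda Reg in
  let ph := phi A L b lambda Reg in
  [/\ (* the two expressions for phi agree, and phi has a gradient *)
      forall y, Omega y ->
        ph y = 2^-1 * enorm (f y) ^+ 2 + Reg y /\ differentiable ph y,
      (* (1) *)
      forall (x : 'cV[R]_n) (y : 'cV[R]_r),
        global_minimizer (cylinder n Omega) F (col_mx x y) ->
        x = pinv (K y) *m d /\ global_minimizer Omega ph y
    & (* (2) *)
      forall (x : 'cV[R]_n) (y : 'cV[R]_r),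
        x = pinv (K y) *m d ->
        (critical_point Omega ph y ->
           critical_point (cylinder n Omega) F (col_mx x y)) /\
        (global_minimizer Omega ph y ->
           global_minimizer (cylinder n Omega) F (col_mx x y))].
Proof.
move=> K d f F ph.
have K_inj y : Omega y -> forall x : 'cV[R]_n, K y *m x = 0 -> x = 0.
  by move=> Oy x; apply: Kmx_inj => //; exact: null_cap.
have dReg y : Omega y -> differentiable Reg y by move=> /RegC1[].
have cylE x y : cylinder n Omega (col_mx x y) = Omega y.
  by rewrite /cylinder /= col_mxKd.
have dph y (Oy : Omega y) v :=
  diff_Fobj_xopt b v (K_inj y Oy) (diffA y Oy) (dReg y Oy).
split=> [y Oy|x y [] |x y ->].
- split; last by have [] := dph y Oy 0.
  rewrite /ph /phi Fobj_col_mx; congr (_ * enorm _ ^+ 2 + _).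
  by rewrite /f /fres /proj_perp mulmxBl mul1mx opprB mulmxA.
- rewrite cylE => Oy Fmin.
  have xE : x = xopt A L b lambda y.
    apply/eqP; rewrite -subr_eq0; apply/eqP/(K_inj y Oy)/enorm_sqr_eq0.
    (* comparing with the inner minimizer kills the quadratic term *)
    have := Fmin (col_mx (xopt A L b lambda y) y); rewrite cylE => /(_ Oy).
    rewrite /F (Fobj_phi b Reg x (K_inj y Oy)) -/(phi A L b lambda Reg y).
    rewrite gerDl pmulr_rle0 ?invr_gt0// => le0.
    by apply/eqP; rewrite eq_le le0 sqr_ge0.
  split=> //; split=> // z Oz.
  have := Fmin (col_mx (xopt A L b lambda z) z); rewrite cylE => /(_ Oz).
  by rewrite xE.
- split=> [[Oy dphy /(gradient_eq0P dphy) dph0]|[Oy phmin]].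
    have dF : differentiable F (col_mx (pinv (K y) *m d) y).
      by apply: differentiable_Fobj; rewrite col_mxKd; [exact: diffA|exact: dReg].
    split=> //; first by rewrite cylE.
    apply/(gradient_eq0P dF) => w; rewrite -[w]vsubmxK.
    by have [_ ->] := dph y Oy (dsubmx w).
  split=> [|z]; first by rewrite cylE.
  rewrite -[z]vsubmxK cylE => Oz.
  by apply: le_trans (phi_le_Fobj b Reg _ (K_inj _ Oz)); exact: phmin.
Qed.
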